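(* Suppose that (a) for every graph $H$ and every integer $k > 2$, if every $H$-free graph is perfectly $(k-2)$-divisible then every $(H \cup K_2)$-free graph is perfectly $k$-divisible, and (b) every $2K_2$-free graph is perfectly $2$-divisible. Then for every integer $p > 1$, every $pK_2$-free graph is perfectly $(2p-2)$-divisible.
   Context: All graphs are finite, simple and undirected. A graph $G$ is $F$-free if it has no induced subgraph isomorphic to $F$. $H \cup K_2$ denotes the disjoint union of $H$ and a single edge $K_2$; $pK_2$ denotes the disjoint union of $p$ copies of $K_2$ (an induced matching of size $p$). $\omega(G)$ denotes the clique number; $G[X]$ is the subgraph induced by $X \subseteq V(G)$. A graph $G$ is perfect if $\chi(H')=\omega(H')$ for every induced subgraph $H'$ of $G$. A graph $G$ is perfectly $1$-divisible if $G$ is perfect. For an integer $k>1$, a graph $G$ is perfectly $k$-divisible if for every induced subgraph $H'$ of $G$, either $V(H')$ is a stable set or $V(H')$ admits a partition into two sets $X_1, X_2$ such that $\omega(H'[X_1]) < \omega(H')$ and $H'[X_2]$ is perfectly $(k-1)$-divisible. *)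

(* Defs.v *)
From mathcomp Require Import all_boot.
Set Implicit Arguments.
Unset Strict Implicit.
Unset Printing Implicit Defensive.

Record sgraph := SGraph {
  vertex :> finType;
  adj : rel vertex;
  adj_sym : symmetric adj;
  adj_irr : irreflexive adj
}.

Definition isomorphic (G H : sgraph) : Prop :=
  exists2 f : G -> H, bijective f & forall x y, adj (f x) (f y) = adj x y.

Section Induced.
Variables (G : sgraph) (X : {set G}).

Definition induced_adj : rel {x : G | x \in X} :=
  [rel u v | adj (val u) (val v)].

Lemma induced_adj_sym : symmetric induced_adj.
Proof. by move=> u v; apply: adj_sym. Qed.

Lemma induced_adj_irr : irreflexive induced_adj.
Proof. by move=> u; apply: adj_irr. Qed.

Definition induced : sgraph := SGraph induced_adj_sym induced_adj_irr.
End Induced.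

Definition free (F G : sgraph) : Prop :=
  forall X : {set G}, ~ isomorphic (induced X) F.

Section DisjointUnion.
Variables G H : sgraph.

Definition dunion_adj : rel (G + H)%type := fun u v =>
  match u, v with
  | inl x, inl y => adj x y
  | inr x, inr y => adj x y
  | _, _ => false
  end.

Lemma dunion_adj_sym : symmetric dunion_adj.
Proof. by move=> [x|x] [y|y] //=; apply: adj_sym. Qed.

Lemma dunion_adj_irr : irreflexive dunion_adj.
Proof. by move=> [x|x] /=; apply: adj_irr. Qed.

Definition dunion : sgraph := SGraph dunion_adj_sym dunion_adj_irr.
End DisjointUnion.

Section Copies.
Variables (p : nat) (G : sgraph).

Definition copies_adj : rel ('I_p * G)%type :=
  [rel u v | (u.1 == v.1) && adj u.2 v.2].

Lemma copies_adj_sym : symmetric copies_adj.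
Proof. by move=> u v; rewrite /copies_adj /= eq_sym adj_sym. Qed.

Lemma copies_adj_irr : irreflexive copies_adj.
Proof. by move=> u; rewrite /copies_adj /= adj_irr andbF. Qed.

Definition copies : sgraph := SGraph copies_adj_sym copies_adj_irr.
End Copies.

Section Complete.
Variable n : nat.

Definition complete_adj : rel 'I_n := [rel x y | x != y].

Lemma complete_adj_sym : symmetric complete_adj.
Proof. by move=> x y; rewrite /complete_adj /= eq_sym. Qed.

Lemma complete_adj_irr : irreflexive complete_adj.
Proof. by move=> x; rewrite /complete_adj /= eqxx. Qed.

Definition complete : sgraph := SGraph complete_adj_sym complete_adj_irr.
End Complete.

Notation K2 := (complete 2).

Section Invariants.
Variable G : sgraph.

Definition clique (A : {set G}) : bool :=
  [forall x in A, forall y in A, (x != y) ==> adj x y].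

Definition stable (A : {set G}) : bool :=
  [forall x in A, forall y in A, ~~ adj x y].

Definition omega : nat := \max_(A : {set G} | clique A) #|A|.

Definition colorable (k : nat) : bool :=
  [exists f : {ffun G -> 'I_k},
     forall x, forall y, adj x y ==> (f x != f y)].

Lemma ex_colorable : exists k, colorable k.
Proof.
exists #|G|; apply/existsP; exists [ffun x => enum_rank x].
apply/forallP=> x; apply/forallP=> y; apply/implyP=> xy.
rewrite !ffunE (inj_eq enum_rank_inj); apply/eqP=> exy.
by rewrite exy adj_irr in xy.
Qed.

Definition chi : nat := ex_minn ex_colorable.
End Invariants.

Definition perfect (G : sgraph) : Prop :=
  forall X : {set G}, chi (induced X) = omega (induced X).

(* Meaningful only for k >= 1; the value at k = 0 is a dummy.  The parts X1
   and X2 may be empty. *)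
Fixpoint perfectly_divisible (k : nat) (G : sgraph) : Prop :=
  match k with
  | 0 => False
  | 1 => perfect G
  | k'.+1 =>
      forall X : {set G}, let H := induced X in
      stable [set: H] \/
      exists X1 X2 : {set H},
        [/\ X1 :|: X2 = [set: H],
            [disjoint X1 & X2],
            omega (induced X1) < omega H
          & perfectly_divisible k' (induced X2)]
  end.

(* Main.v *)
Require Import Defs.
From mathcomp Require Import all_boot.

(** Induction on [p]: (b) is the case [p = 2], and since $(p+1)K_2$ is $pK_2 \cup K_2$, each further
    copy of $K_2$ costs 2 in divisibility by (a). The two graphs are only isomorphic, not equal, so
    [isomorphic_dunion_copies] and [isomorphic_free] carry freeness across. *)

Lemma isomorphic_trans (F G H : sgraph) :
  isomorphic F G -> isomorphic G H -> isomorphic F H.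
Proof.
move=> [f bij_f adj_f] [g bij_g adj_g].
by exists (g \o f) => [|x y]; [apply: bij_comp | rewrite /= adj_g adj_f].
Qed.

Lemma isomorphic_free (F F' G : sgraph) :
  isomorphic F F' -> free F' G -> free F G.
Proof. by move=> isoF freeG X isoX; apply: (freeG X); apply: isomorphic_trans isoF. Qed.

(** The right summand becomes the copy indexed [ord_max]; [lift ord_max] injects the other indices
    and misses [ord_max], so no edge crosses. *)
Lemma isomorphic_dunion_copies (n : nat) (G : sgraph) :
  isomorphic (dunion (copies n G) G) (copies n.+1 G).
Proof.
pose f (u : dunion (copies n G) G) : copies n.+1 G :=
  match u with inl ix => (lift ord_max ix.1, ix.2) | inr x => (ord_max, x) end.
pose g (v : copies n.+1 G) : dunion (copies n G) G :=
  if unlift ord_max v.1 is Some i then inl (i, v.2) else inr v.2.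
exists f.
  exists g; rewrite /f /g; first by move=> [[i x]|x] /=; rewrite ?liftK ?unlift_none.
  by move=> [i x] /=; case: unliftP => [j|] ->.
move=> [[i x]|x] [[j y]|y] //=; rewrite /copies_adj /= ?eqxx //.
- by rewrite (inj_eq lift_inj).
- by rewrite eq_sym (negPf (neq_lift _ _)).
- by rewrite (negPf (neq_lift _ _)).
Qed.

Theorem theorem3
  (ha : forall (H : sgraph) (k : nat), 2 < k ->
     (forall G : sgraph, free H G -> perfectly_divisible (k - 2) G) ->
     forall G : sgraph, free (dunion H K2) G -> perfectly_divisible k G)
  (hb : forall G : sgraph, free (copies 2 K2) G -> perfectly_divisible 2 G)
  (p : nat) (hp : 1 < p) (G : sgraph) :
  free (copies p K2) G -> perfectly_divisible (2 * p - 2) G.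
Proof.
(* [hp] excludes 0 and 1; at 2, [2 * 2 - 2] computes to 2. What remains is [p = q.+3], where
   [k = 2 * p - 2] is at least 4, as (a) demands [2 < k]. *)
elim: p hp G => [//|[//|[|q]] IH] _ G freeG; first exact: hb.
have Ek : 2 * q.+3 - 2 - 2 = 2 * q.+2 - 2 by rewrite [2 * q.+3]mulnS addKn.
apply: (ha (copies q.+2 K2)).
- by rewrite mulnS addKn !mulnS.
- by move=> G'; rewrite Ek; apply: IH.
- exact: isomorphic_free (isomorphic_dunion_copies _ _) freeG.
Qed.
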